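(* Let $\Lambda$ be a finite dimensional local algebra over a field. Then $k\text{-}\operatorname{ddell}\Lambda<\infty$ for every integer $k\ge1$.
   Context: Modules are right $\Lambda$-modules; $\mathrm{mod}\,\Lambda$ denotes the category of finitely generated ones. $\mathbb N$ is the set of nonnegative integers; the infimum of the empty set is $+\infty$. $\Omega M$ is the kernel of a projective cover of $M$, $\Omega^0M=M$, $\Omega^{n+1}M=\Omega(\Omega^nM)$. ''$A$ is a direct summand of $B$ up to projective summands'' means that $A$ is isomorphic to a direct summand of $B\oplus P$ for some projective $P$. For an integer $j\ge1$, $j\text{-}\operatorname{dell}M$ is the infimum of all $n\in\mathbb N$ such that $\Omega^nM$ is a direct summand of $\Omega^{n+j}N$ up to projective summands for some $N\in\mathrm{mod}\,\Lambda$. $k\text{-}\operatorname{ddell}M$ is the infimum of all $m\in\mathbb N$ for which there exist $0\le n\le m$ and an exact sequence $0\to C_n\to\cdots\to C_1\to C_0\to M\to0$ in $\mathrm{mod}\,\Lambda$ with $(i+k)\text{-}\operatorname{dell}C_i\le m-i$ for $i=0,\dots,n$. $k\text{-}\operatorname{ddell}\Lambda=\sup\{k\text{-}\operatorname{ddell}S\mid S\text{ a simple right }\Lambda\text{-module}\}$. *)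

(* Defs.v *)
From HB Require Import structures.
From mathcomp Require Import all_boot all_order all_algebra all_field.
From mathcomp Require Import boolp.

Set Implicit Arguments.
Unset Strict Implicit.
Unset Printing Implicit Defensive.

Import GRing.Theory.
Local Open Scope ring_scope.

(* Extended natural numbers: [None] is +oo. *)
Definition enat := option nat.

Definition ele (x y : enat) : bool :=
  match x, y with
  | _, None => true
  | None, Some _ => false
  | Some m, Some n => (m <= n)%N
  end.

Definition elt (x y : enat) : bool := ~~ ele y x.

Definition einf (P : nat -> Prop) : enat :=
  match pselect (exists n, `[< P n >]) with
  | left h => Some (ex_minn h)
  | right _ => None
  end.

(* The least upper bound, i.e. the infimum of the finite upper bounds. *)
Definition esup (E : enat -> Prop) : enat :=
  einf (fun b => forall v, E v -> ele v (Some b)).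

(* A right A-module is a left module over the converse ring A^c: for a : A^c
   and x in the module, a *: x stands for x . a. *)
Notation rmodType A := (lmodType A^c).

(* A as a right module over itself. *)
Notation regular_rmod A := ((A^c)^o : rmodType A).

Section RightModules.
Variable A : nzRingType.
Implicit Types M N P X Y : rmodType A.

Definition finitely_generated M : Prop :=
  exists (n : nat) (g : 'I_n -> M),
    forall x : M, exists a : 'I_n -> A^c, x = \sum_(i < n) a i *: g i.

Definition surjective_lin M N (f : {linear M -> N}) : Prop :=
  forall y : N, exists x : M, f x = y.

Definition exact_at L M N (f : {linear L -> M}) (g : {linear M -> N}) : Prop :=
  forall y : M, g y = 0 <-> exists x : L, f x = y.

Definition iso_mod M N : Prop := exists f : {linear M -> N}, bijective f.

Definition simple_mod M : Prop :=
  (exists x : M, x != 0) /\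
  forall U : {pred M}, submod_closed U ->
    (forall x, x \in U -> x = 0) \/ (forall x, x \in U).

Definition projective_mod P : Prop :=
  forall M N (g : {linear M -> N}) (f : {linear P -> N}),
    surjective_lin g -> exists h : {linear P -> M}, forall x, g (h x) = f x.

Definition superfluous_ker P M (p : {linear P -> M}) : Prop :=
  forall U : {pred P}, submod_closed U ->
    (forall x : P, exists u v : P, [/\ u \in U, p v = 0 & x = u + v]) ->
    forall x, x \in U.

Definition projective_cover P M (p : {linear P -> M}) : Prop :=
  [/\ finitely_generated P, projective_mod P, surjective_lin p
    & superfluous_ker p].

(* [is_syzygy M X]: X is (isomorphic to) Omega M, the kernel of a projective
   cover of M; this determines X up to isomorphism. *)
Definition is_syzygy M X : Prop :=
  exists P (p : {linear P -> M}) (i : {linear X -> P}),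
    [/\ projective_cover p, injective i & exact_at i p].

(* [is_nsyzygy n M X]: X is (isomorphic to) Omega^n M. *)
Fixpoint is_nsyzygy (n : nat) M X : Prop :=
  if n is n'.+1 then exists Y, is_nsyzygy n' M Y /\ is_syzygy Y X
  else iso_mod M X.

Definition summand_of X Y : Prop :=
  exists Q : rmodType A, iso_mod Y (X * Q)%type.

Definition summand_up_to_proj X Y : Prop :=
  exists P, [/\ finitely_generated P, projective_mod P
              & summand_of X (Y * P)%type].

Definition dell (j : nat) M : enat :=
  einf (fun n => exists X N Y,
    [/\ is_nsyzygy n M X, finitely_generated N, is_nsyzygy (n + j) N Y
      & summand_up_to_proj X Y]).

(* Exact sequences 0 -> C_n -> ... -> C_1 -> C_0 -> M -> 0 in mod A, the
   complex C being extended by zero modules in degrees > n. *)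
Definition exact_resolution (n : nat) M (C : nat -> rmodType A)
    (d : forall i, {linear C i.+1 -> C i}) (e : {linear C 0%N -> M}) : Prop :=
  [/\ forall i, finitely_generated (C i),
      forall i, (n < i)%N -> forall x : C i, x = 0,
      surjective_lin e,
      exact_at (d 0%N) e
    & forall i, exact_at (d i.+1) (d i)].

Definition ddell (k : nat) M : enat :=
  einf (fun m => exists n : nat, (n <= m)%N /\
    exists (C : nat -> rmodType A) (d : forall i, {linear C i.+1 -> C i})
           (e : {linear C 0%N -> M}),
      exact_resolution n d e /\
      forall i, (i <= n)%N -> ele (dell (i + k) (C i)) (Some (m - i)%N)).

Definition ddell_ring (k : nat) : enat :=
  esup (fun v => exists S : rmodType A, simple_mod S /\ v = ddell k S).

Definition maximal_right_ideal (I : {pred regular_rmod A}) : Prop :=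
  [/\ submod_closed I, exists x, x \notin I
    & forall J : {pred regular_rmod A}, submod_closed J ->
        {subset I <= J} -> J =i I \/ forall x, x \in J].

Definition local_ring : Prop :=
  exists I : {pred regular_rmod A}, maximal_right_ideal I /\
    forall J : {pred regular_rmod A}, maximal_right_ideal J -> J =i I.

End RightModules.

(* Main.v *)
Require Import Defs.
From HB Require Import structures.
From mathcomp Require Import all_boot all_order all_algebra all_field.
From mathcomp Require Import boolp zify.

Set Implicit Arguments.
Unset Strict Implicit.
Unset Printing Implicit Defensive.

Import GRing.Theory.
Local Open Scope ring_scope.

(* Call [M] k-resolvable ([dres k M]) when it has a finite resolution whose term
   in degree [i] has finite (i + k)-dell; this says that k-ddell M is finite.
   Syzygies raise [k] by one: if [L -> C -> M] is the start of a resolution and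
   [P -> M], [R -> L] are projective covers, then the kernel [Y] of [P + R -> C]
   maps onto the syzygy of [M] with kernel the syzygy of [L].  Consequently
   k-resolvable modules are closed under extensions: if [N -> B -> C] is exact,
   [X -> N] is the first map of a resolution with kernel [L] and [P -> C] is a
   projective cover, then [X + P] maps onto [B], with kernel an extension of the
   syzygy of [C] by [L], and one recurses on the shorter resolution of [L].
   Every module is 0-resolvable.  If all finitely generated modules are
   k-resolvable, then the simple module [T] is (k+1)-resolvable, being a right
   ideal and thus the syzygy of [A / T]; as all simple modules of a local ring
   are isomorphic, composition series make all modules (k+1)-resolvable. *)

(** * Submodules and quotient modules *)

Section SubQuotient.
Variables (A : nzRingType) (M : rmodType A) (U : {pred M}).

(** The phantom argument [hU] lets structure inference recover the closure proof from the predicate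
    alone. *)
Definition submod_pred (hU : submod_closed U) : {pred M} := U.

Variable hU : submod_closed U.

HB.instance Definition _ :=
  GRing.isSubmodClosed.Build A^c M (submod_pred hU) hU.

Record submod_of := Submod { submod_val : M; _ : submod_val \in submod_pred hU }.

HB.instance Definition _ := [isSub for submod_val].
HB.instance Definition _ := [Choice of submod_of by <:].
HB.instance Definition _ := [SubChoice_isSubLmodule of submod_of by <:].

Definition quotmod := Quotient.quot (submod_pred hU).

HB.instance Definition _ := GRing.Zmodule.on quotmod.

Definition quot_pi (x : M) : quotmod := (\pi_(Quotient.quot (submod_pred hU)) x)%qT.

Lemma quot_piP (x y : M) : quot_pi x = quot_pi y <-> x - y \in U.
Proof.
rewrite -[x - y \in U]/(x - y \in submod_pred hU) Quotient.idealrBE.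
by split=> [h|/eqP //]; apply/eqP.
Qed.

Lemma quot_piD : {morph quot_pi : x y / x + y}.
Proof. by move=> x y; rewrite /quot_pi raddfD. Qed.

Lemma quot_pi_surj (y : quotmod) : exists x, quot_pi x = y.
Proof. by exists (generic_quotient.repr y); apply: generic_quotient.reprK. Qed.

Definition quot_scale (a : A^c) (y : quotmod) : quotmod :=
  quot_pi (a *: generic_quotient.repr y).

Lemma quot_scaleE a x : quot_scale a (quot_pi x) = quot_pi (a *: x).
Proof.
apply/quot_piP; rewrite -scalerBr -[_ \in U]/(_ \in submod_pred hU) rpredZ //.
by apply/quot_piP; apply: generic_quotient.reprK.
Qed.

Lemma quot_scalerA a b v :
  quot_scale a (quot_scale b v) = quot_scale (a * b) v.
Proof. by have [x <-] := quot_pi_surj v; rewrite !quot_scaleE scalerA. Qed.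

Lemma quot_scale1r : left_id 1 quot_scale.
Proof. by move=> v; have [x <-] := quot_pi_surj v; rewrite quot_scaleE scale1r. Qed.

Lemma quot_scalerDr : right_distributive quot_scale +%R.
Proof.
move=> a u v; have [x <-] := quot_pi_surj u; have [y <-] := quot_pi_surj v.
by rewrite -quot_piD !quot_scaleE scalerDr quot_piD.
Qed.

Lemma quot_scalerDl v : {morph quot_scale^~ v : a b / a + b}.
Proof.
by move=> a b; have [x <-] := quot_pi_surj v; rewrite !quot_scaleE scalerDl quot_piD.
Qed.

HB.instance Definition _ := GRing.Zmodule_isLmodule.Build A^c quotmod
  quot_scalerA quot_scale1r quot_scalerDr quot_scalerDl.

End SubQuotient.

(** * Linear maps, short exact sequences and finitely generated projectives *)

Section Modules.
Variable A : nzRingType.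
Implicit Types B C E K L M N P Q R X Y : rmodType A.

Definition mklin M N (f : M -> N) (lf : linear f) : {linear M -> N} :=
  HB.pack f (GRing.isLinear.Build _ _ _ _ f lf).

Lemma exists_lin M N (f : M -> N) :
  linear f -> exists g : {linear M -> N}, forall x, g x = f x.
Proof. by move=> lf; exists (mklin lf). Qed.

Definition pair_lin M N X (f : {linear X -> M}) (g : {linear X -> N}) :
  {linear X -> (M * N)%type}.
Proof.
refine (@mklin X (M * N)%type (fun x => (f x, g x)) _).
by move=> a x y; rewrite !linearP.
Defined.

Definition copair_lin M N X (f : {linear M -> X}) (g : {linear N -> X}) :
  {linear (M * N)%type -> X}.
Proof.
refine (@mklin (M * N)%type X (fun x => f x.1 + g x.2) _).
by move=> a x y; rewrite /= !linearP scalerDr addrACA.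
Defined.

Definition fst_lin M N : {linear (M * N)%type -> M}.
Proof. by refine (@mklin (M * N)%type M fst _). Defined.

Definition snd_lin M N : {linear (M * N)%type -> N}.
Proof. by refine (@mklin (M * N)%type N snd _). Defined.

Definition inl_lin M N : {linear M -> (M * N)%type} := pair_lin idfun \0.
Definition inr_lin M N : {linear N -> (M * N)%type} := pair_lin \0 idfun.

Definition orbit_lin M (x : M) : {linear regular_rmod A -> M}.
Proof.
refine (@mklin (regular_rmod A) M (fun a : A^c => a *: x) _).
by move=> a b c; rewrite scalerDl scalerA.
Defined.

Lemma submod_ex M (U : {pred M}) : submod_closed U ->
  exists X (i : {linear X -> M}), injective i /\ forall y, y \in U <-> exists x, i x = y.
Proof.
move=> hU; exists (submod_of hU), (val : {linear submod_of hU -> M}).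
split=> [|y]; first exact: val_inj.
split=> [yU|[x <-]]; last exact: (valP x).
by exists (Submod (hU := hU) yU).
Qed.

Lemma quotient_ex M (U : {pred M}) : submod_closed U ->
  exists X (p : {linear M -> X}), surjective_lin p /\ forall x, p x = 0 <-> x \in U.
Proof.
move=> hU; exists (quotmod hU).
have [|p pE] := @exists_lin M (quotmod hU) (quot_pi hU).
  by move=> a x y; rewrite quot_piD -quot_scaleE.
exists p; split=> [y|x].
  by have [x <-] := quot_pi_surj y; exists x.
by rewrite -(linear0 p) !pE quot_piP subr0.
Qed.

(** Preimages under [i] are unique, so choosing them pointwise is automatically linear. *)
Lemma lin_factor_inj K M X (i : {linear K -> M}) (f : {linear X -> M}) :
  injective i -> (forall x, exists y, i y = f x) ->
  exists h : {linear X -> K}, forall x, i (h x) = f x.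
Proof.
move=> inji /choice [h hE].
have [|h' h'E] := @exists_lin X K h; last by exists h' => x; rewrite h'E.
by move=> a x y; apply: inji; rewrite linearP !hE linearP.
Qed.

(** Compose [f] with a set-theoretic section of [p]: two preimages of a point differ by an element
    of the kernel, which [f] kills. *)
Lemma lin_factor_surj M N X (p : {linear M -> N}) (f : {linear M -> X}) :
  surjective_lin p -> (forall x, p x = 0 -> f x = 0) ->
  exists h : {linear N -> X}, forall x, h (p x) = f x.
Proof.
move=> /choice [s sE] pf.
have fs y z : p y = z -> f (s z) = f y.
  by move=> yz; apply/subr0_eq; rewrite -linearB pf // linearB /= sE yz subrr.
have [|h hE] := @exists_lin N X (f \o s).
  move=> a x y; rewrite /= -linearP; apply: fs.
  by rewrite linearP !sE.
by exists h => x; rewrite hE; apply: fs.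
Qed.

Definition ses K M N (i : {linear K -> M}) (p : {linear M -> N}) : Prop :=
  [/\ injective i, surjective_lin p & exact_at i p].

Lemma ker_closed M N (f : {linear M -> N}) : submod_closed [pred x | f x == 0].
Proof.
split=> [|a x y]; rewrite !inE ?linear0 // => /eqP fx /eqP fy.
by rewrite linearP fx fy scaler0 addr0.
Qed.

Lemma im_closed M N (f : {linear M -> N}) :
  submod_closed [pred y | `[< exists x, f x = y >]].
Proof.
split=> [|a x y]; rewrite !inE; first by apply/asboolP; exists 0; rewrite linear0.
move=> /asboolP [u <-] /asboolP [v <-]; apply/asboolP.
by exists (a *: u + v); rewrite linearP.
Qed.

Lemma preim_closed M N (f : {linear M -> N}) (U : {pred N}) :
  submod_closed U -> submod_closed [pred x | f x \in U].
Proof.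
move=> [U0 UP]; split=> [|a x y]; rewrite !inE ?linear0 // => fx fy.
by rewrite linearP; apply: UP.
Qed.

Lemma ker_ses M N (p : {linear M -> N}) : surjective_lin p ->
  exists K (i : {linear K -> M}), ses i p.
Proof.
move=> ps; have [K [i [inji iE]]] := submod_ex (ker_closed p).
exists K, i; split=> // y; split=> [/eqP/iE //|/iE].
by rewrite inE => /eqP.
Qed.

Lemma coker_ses K M (i : {linear K -> M}) : injective i ->
  exists N (p : {linear M -> N}), ses i p.
Proof.
move=> inji; have [N [p [ps pE]]] := quotient_ex (im_closed i).
exists N, p; split=> // y; split=> [/pE|h].
  by rewrite inE => /asboolP.
by apply/pE; rewrite inE; apply/asboolP.
Qed.

Lemma ses0 K M N (i : {linear K -> M}) (p : {linear M -> N}) :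
  ses i p -> forall x, p (i x) = 0.
Proof. by case=> _ _ e x; apply/e; exists x. Qed.

Lemma fg_surj M N (f : {linear M -> N}) :
  surjective_lin f -> finitely_generated M -> finitely_generated N.
Proof.
move=> fs [n [g gE]]; exists n, (f \o g) => y; have [x <-] := fs y.
have [a ->] := gE x; exists a; rewrite linear_sum; apply: eq_bigr => i _.
by rewrite linearZ.
Qed.

Lemma fg_prod M N :
  finitely_generated M -> finitely_generated N -> finitely_generated (M * N)%type.
Proof.
move=> [m [g gE]] [n [h hE]].
exists (m + n)%N, (fun i => match split i with
  inl j => inl_lin M N (g j) | inr j => inr_lin M N (h j) end) => [[x y]].
have [a ->] := gE x; have [b ->] := hE y.
exists (fun i => match split i with inl j => a j | inr j => b j end).
have splitl i : split (lshift n i) = inl i := unsplitK (inl i).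
have splitr i : split (rshift m i) = inr i := unsplitK (inr i).
rewrite big_split_ord /=.
transitivity (inl_lin M N (\sum_(i < m) a i *: g i)
              + inr_lin M N (\sum_(i < n) b i *: h i)).
  by congr pair; rewrite /= ?addr0 ?add0r.
rewrite !linear_sum; congr (_ + _); apply: eq_bigr => i _.
  by rewrite splitl linearZ.
by rewrite splitr linearZ.
Qed.

Lemma fg_regular : finitely_generated (regular_rmod A).
Proof.
exists 1%N, (fun=> (1 : A^c)) => x; exists (fun=> x).
by rewrite big_ord1 -[_ *: _]/(x * 1) mulr1.
Qed.

Lemma projective_regular : projective_mod (regular_rmod A).
Proof.
move=> M N g f gs; have [x xE] := gs (f (1 : A^c)).
exists (orbit_lin x) => a; rewrite linearZ /= xE -linearZ.
by rewrite -[a *: _]/((a : A^c) * 1) mulr1.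
Qed.

Lemma projective_prod P Q :
  projective_mod P -> projective_mod Q -> projective_mod (P * Q)%type.
Proof.
move=> hP hQ M N g f gs.
have [h1 h1E] := hP M N g (f \o inl_lin P Q) gs.
have [h2 h2E] := hQ M N g (f \o inr_lin P Q) gs.
exists (copair_lin h1 h2) => -[x y].
rewrite linearD h1E h2E /= -linearD; congr (f (_, _)) => /=.
  by rewrite addr0.
by rewrite add0r.
Qed.

Lemma projective_retract P E (r : {linear P -> E}) (i : {linear E -> P}) :
  cancel i r -> projective_mod P -> projective_mod E.
Proof.
move=> ri hP M N g f gs; have [h hE] := hP M N g (f \o r) gs.
by exists (h \o i) => x; rewrite /= hE /= ri.
Qed.

Definition fgproj P := finitely_generated P /\ projective_mod P.

Lemma fgproj_regular : fgproj (regular_rmod A).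
Proof. by split; [apply: fg_regular | apply: projective_regular]. Qed.

Lemma fgproj_prod P Q : fgproj P -> fgproj Q -> fgproj (P * Q)%type.
Proof.
by move=> [fgP pP] [fgQ pQ]; split; [apply: fg_prod | apply: projective_prod].
Qed.

Lemma fg_proj_surj M : finitely_generated M ->
  exists P (p : {linear P -> M}), fgproj P /\ surjective_lin p.
Proof.
move=> [n [g gE]].
(* Weakened to hitting all combinations of an arbitrary family, so that the induction can pass to
   the tail of [g]. *)
suff [P [p [hP pE]]] : exists P (p : {linear P -> M}), fgproj P /\
    forall a : 'I_n -> A^c, exists x, p x = \sum_(i < n) a i *: g i.
  exists P, p; split=> // y; have [a ->] := gE y; exact: pE.
elim: n g {gE} => [|n IHn] g.
  exists (regular_rmod A), \0; split=> [|a]; first exact: fgproj_regular.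
  by exists 0; rewrite big_ord0.
have [P [p [hP pE]]] := IHn (fun i => g (lift ord0 i)).
exists (regular_rmod A * P)%type, (copair_lin (orbit_lin (g ord0)) p).
split=> [|a]; first exact: fgproj_prod fgproj_regular hP.
have [x xE] := pE (fun i => a (lift ord0 i)).
by exists (a ord0, x); rewrite big_ord_recl -xE.
Qed.

End Modules.

(** * Stable retracts, syzygies and delooping *)

Section Syzygies.
Variable A : nzRingType.
Implicit Types B C E K L M N P Q R X Y Z : rmodType A.

Lemma iso_inv M N : iso_mod M N ->
  exists (f : {linear M -> N}) (g : {linear N -> M}), cancel f g /\ cancel g f.
Proof.
case=> f [g fg gf]; have [|g' g'E] := @exists_lin A N M g.
  by move=> a x y; apply: (can_inj fg); rewrite linearP !gf.
by exists f, g'; split=> x; rewrite g'E.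
Qed.

Lemma iso_refl M : iso_mod M M.
Proof. by exists idfun; exists idfun. Qed.

(* [X] is a direct summand of [Y] up to projective summands, with the summand
   presented as a retract: the identity of [X] is a map through [Y] plus a map
   through a finitely generated projective. *)
Definition stable_retract X Y : Prop :=
  exists P (f : {linear X -> Y}) (g : {linear Y -> X})
         (a : {linear X -> P}) (b : {linear P -> X}),
    fgproj P /\ forall x, g (f x) + b (a x) = x.

Lemma stable_retract_iso X Y : iso_mod X Y -> stable_retract X Y.
Proof.
move=> /iso_inv [f [g [fg _]]].
exists (regular_rmod A), f, g, \0, \0; split=> [|x]; first exact: fgproj_regular.
by rewrite fg /= addr0.
Qed.

Lemma stable_retract_refl X : stable_retract X X.
Proof. exact: stable_retract_iso (iso_refl X). Qed.

Lemma stable_retract_trans X Y Z :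
  stable_retract X Y -> stable_retract Y Z -> stable_retract X Z.
Proof.
move=> [P [f [g [a [b [hP fgab]]]]]] [Q [f' [g' [a' [b' [hQ fgab']]]]]].
exists (P * Q)%type, (f' \o f), (g \o g'), (pair_lin a (a' \o f)),
  (copair_lin b (g \o b')); split=> [|x]; first exact: fgproj_prod.
by rewrite /= [b _ + _]addrC addrA -linearD fgab' fgab.
Qed.

Lemma stable_retract_addproj X P : fgproj P -> stable_retract (X * P)%type X.
Proof.
move=> hP; exists P, (fst_lin X P), (inl_lin X P), (snd_lin X P), (inr_lin X P).
by split=> // -[x y]; congr pair; rewrite /= ?addr0 ?add0r.
Qed.

(** The complement is the kernel of [v], and the projection onto it is the identity minus
    [u \o v]. *)
Lemma retract_summand X Z (u : {linear X -> Z}) (v : {linear Z -> X}) :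
  cancel u v -> summand_of X Z.
Proof.
move=> vu; have vs : surjective_lin v by move=> x; exists (u x); rewrite vu.
have [Q [i Si]] := ker_ses vs; have vi := ses0 Si; case: Si => inji _ iv.
have [|t tE] := @lin_factor_inj A Q _ _ i (idfun \- (u \o v)) inji.
  by move=> x; apply/iv; rewrite linearB /= vu subrr.
exists Q, (pair_lin v t), (fun xq => u xq.1 + i xq.2) => [x|[x q]].
  by rewrite /= tE /= addrC subrK.
congr pair; first by rewrite linearD vu vi addr0.
by apply: inji; rewrite tE /= linearD vu vi addr0 addrC addKr.
Qed.

Lemma stable_retract_summand X Y : stable_retract X Y -> summand_up_to_proj X Y.
Proof.
move=> [P [f [g [a [b [[fgP pP] fgab]]]]]]; exists P; split=> //.
exact: (@retract_summand X _ (pair_lin f a) (copair_lin g b)).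
Qed.

(** Minimality of the cover is dropped: the kernel is then determined only up to projective
    summands, which is all that [dell] sees. *)
Definition syz M X : Prop :=
  exists P (p : {linear P -> M}) (i : {linear X -> P}), fgproj P /\ ses i p.

Fixpoint nsyz (n : nat) M X : Prop :=
  if n is n'.+1 then exists Y, nsyz n' M Y /\ syz Y X else iso_mod M X.

Lemma is_syzygy_syz M X : is_syzygy M X -> syz M X.
Proof. by move=> [P [p [i [[? ? ? _] ? ?]]]]; exists P, p, i. Qed.

Lemma is_nsyzygy_nsyz n M X : is_nsyzygy n M X -> nsyz n M X.
Proof.
elim: n X => [//|n IHn] X [Y [/IHn hY /is_syzygy_syz hX]].
by exists Y.
Qed.

(** [nsyz] unfolds at the last syzygy; this adds one at the front. *)
Lemma nsyz_cons n M N X : syz M N -> nsyz n N X -> nsyz n.+1 M X.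
Proof.
move=> MN; elim: n X => [|n IHn] X; last first.
  by move=> [Y [/IHn hY YX]]; exists Y.
move=> /iso_inv [f [g [fg gf]]]; exists M; split; first exact: iso_refl.
have [P [p [i [hP [inji ps ip]]]]] := MN; exists P, p, (i \o g).
split=> //; split=> // [|y]; first exact: inj_comp inji (can_inj gf).
rewrite ip; split=> -[x <-]; last by exists (g x).
by exists (f x); rewrite /= fg.
Qed.

(** A form of Schanuel's lemma. Lift [f], [g], [b] to maps [F], [G], [H] into the covers. On [PX],
    the identity minus [G F + H a p] is killed by [p], hence equals [i s]; restricted to [X'], where
    [p] vanishes, this gives [g' f' + s i = 1], and [s i] passes through the projective [PX]. *)
Lemma stable_retract_syz X Y X' Y' :
  stable_retract X Y -> syz X X' -> syz Y Y' -> stable_retract X' Y'.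
Proof.
move=> [P [f [g [a [b [[_ pP] fgab]]]]]].
move=> [PX [p [i [[fgPX pPX] Sip]]]] [PY [q [j [[_ pPY] Sjq]]]].
have pi := ses0 Sip; have qj := ses0 Sjq.
case: Sip Sjq => inji ps ip [injj qs jq].
have [F FE] := pPX _ _ q (f \o p) qs.
have [G GE] := pPY _ _ p (g \o q) ps.
have [H HE] := pP _ _ p b ps.
have [|f' f'E] := @lin_factor_inj A Y' _ _ j (F \o i) injj.
  by move=> x; apply/jq; rewrite /= FE /= pi linear0.
have [|g' g'E] := @lin_factor_inj A X' _ _ i (G \o j) inji.
  by move=> x; apply/ip; rewrite /= GE /= qj linear0.
have [|s sE] := @lin_factor_inj A X' _ _ i
    (idfun \- ((G \o F) \+ (H \o (a \o p)))) inji.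
  move=> x; apply/ip.
  by rewrite linearB linearD /= GE /= FE HE /= fgab subrr.
exists PX, f', g', i, s; split=> [//|x]; apply: inji.
by rewrite linearD g'E /= f'E sE /= pi !linear0 addr0 addrC subrK.
Qed.

Lemma stable_retract_nsyz n X Y X' Y' :
  stable_retract X Y -> nsyz n X X' -> nsyz n Y Y' -> stable_retract X' Y'.
Proof.
move=> XY; elim: n X' Y' => [|n IHn] X' Y'.
  move=> /iso_inv [f [g [fg gf]]] YY'.
  apply: stable_retract_trans (stable_retract_iso YY').
  apply: stable_retract_trans XY; apply: stable_retract_iso.
  by exists g; exists f.
move=> [X1 [hX1 X1X']] [Y1 [hY1 Y1Y']].
exact: stable_retract_syz (IHn _ _ hX1 hY1) X1X' Y1Y'.
Qed.

Definition has_syzygies : Prop :=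
  forall M, finitely_generated M -> exists X, is_syzygy M X /\ finitely_generated X.

(** Finiteness of the [j]-dell, with arbitrary projectives in place of covers and retracts in place
    of summands. *)
Definition deloops (j : nat) M : Prop :=
  exists n X N Y, [/\ nsyz n M X, finitely_generated N, nsyz (n + j) N Y
                    & stable_retract X Y].

Hypothesis hsyz : has_syzygies.

Lemma is_nsyzygy_ex n M : finitely_generated M ->
  exists X, is_nsyzygy n M X /\ finitely_generated X.
Proof.
move=> fgM; elim: n => [|n [X [hX fgX]]]; first by exists M; split=> //; apply: iso_refl.
by have [Y [XY fgY]] := hsyz fgX; exists Y; split=> //; exists X.
Qed.

Lemma nsyz_ex n M : finitely_generated M -> exists X, nsyz n M X.
Proof.
by move=> /(is_nsyzygy_ex n) [X [/is_nsyzygy_nsyz hX _]]; exists X.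
Qed.

Lemma einf_le (P : nat -> Prop) n : P n -> exists m, einf P = Some m /\ (m <= n)%N.
Proof.
rewrite /einf => Pn; case: pselect => [h|[]]; last by exists n; apply/asboolP.
by exists (ex_minn h); split=> //; case: ex_minnP => m _; apply; apply/asboolP.
Qed.

(** Minimal syzygies exist by [hsyz] and are stable retracts of arbitrary ones, and conversely, so
    the same [n] and [N] serve. *)
Lemma deloops_dell j M : finitely_generated M -> deloops j M ->
  exists m, dell j M = Some m.
Proof.
move=> fgM [n [X [N [Y [MX fgN NY XY]]]]].
have [X' [MX' _]] := is_nsyzygy_ex n fgM.
have [Y' [NY' _]] := is_nsyzygy_ex (n + j) fgN.
pose D n := exists X N Y, [/\ is_nsyzygy n M X, finitely_generated N,
  is_nsyzygy (n + j) N Y & summand_up_to_proj X Y].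
have [|m [mE _]] := @einf_le D n; last by exists m.
exists X', N, Y'; split=> //; apply: stable_retract_summand.
have X'X := stable_retract_nsyz (stable_retract_refl M) (is_nsyzygy_nsyz MX') MX.
have YY' := stable_retract_nsyz (stable_retract_refl N) NY (is_nsyzygy_nsyz NY').
exact: stable_retract_trans X'X (stable_retract_trans XY YY').
Qed.

Lemma deloops_retract j M M' : finitely_generated M' ->
  stable_retract M' M -> deloops j M -> deloops j M'.
Proof.
move=> fgM' M'M [n [X [N [Y [MX fgN NY XY]]]]].
have [X' M'X'] := nsyz_ex n fgM'; exists n, X', N, Y; split=> //.
exact: stable_retract_trans (stable_retract_nsyz M'M M'X' MX) XY.
Qed.

(** The [n]-th syzygy of [M'] is the [n.+1]-st of [M]; taking one more syzygy on both sides keeps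
    [n] and [N] and raises [j] by one. *)
Lemma deloops_syz j M M' : finitely_generated M' ->
  syz M M' -> deloops j M -> deloops j.+1 M'.
Proof.
move=> fgM' MM' [n [X [N [Y [MX fgN NY XY]]]]].
have [X' M'X'] := nsyz_ex n fgM'.
have [Y' NY'] := nsyz_ex (n + j).+1 fgN.
exists n, X', N, Y'; split=> //; first by rewrite addnS.
have [W [MW WX']] := nsyz_cons MM' M'X'; case: NY' => V [NV VY'].
have WX := stable_retract_nsyz (stable_retract_refl M) MW MX.
have YV := stable_retract_nsyz (stable_retract_refl N) NY NV.
have WV := stable_retract_trans WX (stable_retract_trans XY YV).
exact: stable_retract_syz WV WX' VY'.
Qed.

Lemma deloops0 M : finitely_generated M -> deloops 0 M.
Proof.
move=> fgM; exists 0%N, M, M, M.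
by split=> //; [apply: iso_refl | apply: iso_refl | apply: stable_retract_refl].
Qed.

Lemma deloops_zero j M : finitely_generated M -> (forall x : M, x = 0) -> deloops j M.
Proof.
move=> fgM M0; have [Y MY] := nsyz_ex j fgM.
exists 0%N, M, M, Y; split=> //; first exact: iso_refl.
exists (regular_rmod A), \0, \0, \0, \0; split=> [|x]; first exact: fgproj_regular.
by rewrite [RHS]M0 [LHS]M0.
Qed.

End Syzygies.

(** * Resolvable modules: syzygies, extensions and finiteness of [ddell] *)

Section DeloopingResolutions.
Variable A : nzRingType.
Implicit Types B C E K L M N P Q R X Y Z : rmodType A.

(** Each step peels off the term of degree 0 and raises the index for the kernel, so the term of
    degree [i] is tested at [i + k]; [dres_base] supplies the leftmost term. *)
Inductive dres : nat -> rmodType A -> Prop :=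
| dres_base k M : finitely_generated M -> deloops k M -> dres k M
| dres_step k K C M (i : {linear K -> C}) (p : {linear C -> M}) :
    ses i p -> finitely_generated C -> deloops k C -> dres k.+1 K -> dres k M.

Lemma dres_fg k M : dres k M -> finitely_generated M.
Proof. by case=> // {}k K C {}M i p [_ ps _] fgC _ _; apply: fg_surj ps fgC. Qed.

Definition noetherian : Prop :=
  forall M K (i : {linear K -> M}),
    injective i -> finitely_generated M -> finitely_generated K.

Hypotheses (hsyz : has_syzygies A) (hnoeth : noetherian).

Lemma dres_syz k M : dres k M ->
  forall K P (i : {linear K -> P}) (p : {linear P -> M}),
    fgproj P -> ses i p -> dres k.+1 K.
Proof.
elim=> {k M} [k M fgM dM|k L C M j q Sjq fgC dC _ IH] K P i p hP Sip.
  have fgK : finitely_generated K by case: Sip hP => inji _ _ [fgP _]; apply: hnoeth inji fgP.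
  by apply: dres_base => //; apply: deloops_syz dM => //; exists P, p, i.
have qj := ses0 Sjq; have pi := ses0 Sip.
case: Sjq Sip => injj qs jq [inji ps ip].
have [fgP pP] := hP; have [phi phiE] := pP _ _ q p qs.
have [R [rho [hR rhos]]] := fg_proj_surj (hnoeth injj fgC).
have [L' [l Sl]] := ker_ses rhos; have rhol := ses0 Sl.
have dL' := IH _ _ _ _ hR Sl; case: Sl => injl _ lrho.
(* [phi] covers [C] modulo [L] and [rho] covers [L], so [c] is onto and its kernel [Y] is a syzygy
   of [C]. *)
pose c := copair_lin phi (j \o rho).
have cE x : c x = phi x.1 + j (rho x.2) by [].
have cs : surjective_lin c.
  move=> y; have [x xE] := ps (q y); have /jq [z zE] : q (y - phi x) = 0.
    by rewrite linearB phiE xE subrr.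
  by have [r rE] := rhos z; exists (x, r); rewrite cE /= rE zE addrC subrK.
have [Y [y Sy]] := ker_ses cs; have cy := ses0 Sy; have [injy _ yc] := Sy.
have [|t tE] := @lin_factor_inj A K _ _ i (fst_lin P R \o y) inji.
  move=> x; apply/ip; have := congr1 q (cy x).
  by rewrite cE linearD qj addr0 phiE linear0.
have [|s sE] := @lin_factor_inj A Y _ _ y (inr_lin P R \o l) injy.
  by move=> x; apply/yc; rewrite cE /= rhol !linear0 addr0.
have hPR := fgproj_prod hP hR.
have fgY : finitely_generated Y by case: hPR => fgPR _; apply: hnoeth injy fgPR.
(* The new first step is [L' -> Y -> K]; the syzygy [L'] of [L] is resolvable at [k.+2] by
   induction. *)
apply: (@dres_step _ _ _ _ s t) => //; last first.
  by apply: deloops_syz dC => //; exists (P * R)%type, c, y.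
split=> [x x' ss|x|x].
- by apply: injl; have := congr1 y ss; rewrite !sE => -[].
- have /jq [z zE] : q (phi (i x)) = 0 by rewrite phiE pi.
  have [r rE] := rhos (- z).
  have /yc [w wE] : c (i x, r) = 0 by rewrite cE /= rE linearN zE subrr.
  by exists w; apply: inji; rewrite tE /= wE.
- split=> [tx0|[z <-]]; last by apply: inji; rewrite tE /= sE /= linear0.
  have y1 : (y x).1 = 0 by have := tE x; rewrite tx0 linear0.
  have /lrho [z zE] : rho (y x).2 = 0.
    by apply: injj; have := cy x; rewrite cE y1 !linear0 add0r.
  by exists z; apply: injy; rewrite sE /= [RHS]surjective_pairing y1 zE.
Qed.

(** The surjectivity part of the horseshoe lemma; only [P] has to be lifted, so [X] may be any
    module. *)
Lemma ses_cover N B C X (alpha : {linear N -> B}) (beta : {linear B -> C})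
    P (p : {linear P -> C}) (e : {linear X -> N}) :
  ses alpha beta -> projective_mod P -> surjective_lin p -> surjective_lin e ->
  exists2 psi : {linear P -> B}, forall u, beta (psi u) = p u &
    surjective_lin (copair_lin (alpha \o e) psi).
Proof.
move=> [inja bs ab] pP ps es; have [psi psiE] := pP _ _ beta p bs.
exists psi => // b; have [u uE] := ps (beta b).
have /ab [n nE] : beta (b - psi u) = 0 by rewrite linearB psiE uE subrr.
by have [x xE] := es n; exists (x, u); rewrite /= xE nE subrK.
Qed.

Lemma dres_ext k N : dres k N ->
  forall B C (alpha : {linear N -> B}) (beta : {linear B -> C}),
    ses alpha beta -> dres k C -> dres k B.
Proof.
elim=> {k N} [k N fgN dN|k L X N j e Sje fgX dX _ IH] B C alpha beta S dC;
  have [P [p [hP ps]]] := fg_proj_surj (dres_fg dC); have [fgP pP] := hP;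
  have ba := ses0 S; have [inja _ ab] := S.
  (* Base case: take [N] itself for [X]. The second component identifies the kernel of [N + P -> B]
     with the kernel of [p], a syzygy of [C]. *)
  have ids : surjective_lin (idfun : {linear N -> N}) by move=> x; exists x.
  have [psi psiE cs] := ses_cover S pP ps ids.
  have [K [i Sic]] := ker_ses cs; have [inji _ ic] := Sic.
  have ci x : alpha (i x).1 + psi (i x).2 = 0 := ses0 Sic x.
  apply: (dres_step Sic (fg_prod fgN fgP)).
    exact: deloops_retract (fg_prod fgN fgP) (stable_retract_addproj N hP) dN.
  apply: (dres_syz dC (i := snd_lin N P \o i) (p := p)) => //; split=> // [x y xy|u].
    have xy2 : (i x).2 = (i y).2 by exact: xy.
    apply: inji; rewrite [LHS]surjective_pairing [RHS]surjective_pairing xy2.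
    by congr pair; apply/inja/(addIr (psi (i x).2)); rewrite {2}xy2 !ci.
  rewrite -psiE; split=> [/ab [n nE]|[x <-]].
    have /ic [x xE] : copair_lin (alpha \o idfun) psi (- n, u) = 0.
      by rewrite /= linearN nE addNr.
    by exists x; rewrite /= xE.
  by have := congr1 beta (ci x); rewrite linearD ba add0r linear0.
(* Inductive case: the kernel [K] is an extension of the syzygy [W] of [C] by [L], to which the
   induction hypothesis for [L] applies. *)
have [_ es _] := Sje; have ej := ses0 Sje.
have [psi psiE cs] := ses_cover S pP ps es.
have [K [i Sic]] := ker_ses cs; have [inji _ ic] := Sic.
have ci x : alpha (e (i x).1) + psi (i x).2 = 0 := ses0 Sic x.
apply: (dres_step Sic (fg_prod fgX fgP)).
  exact: deloops_retract (fg_prod fgX fgP) (stable_retract_addproj X hP) dX.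
have [W [w Sw]] := ker_ses ps; have dW := dres_syz dC hP Sw.
have pw := ses0 Sw; case: Sw => injw _ wp; case: Sje => injj _ je.
have [|s sE] := @lin_factor_inj A K _ _ i (inl_lin X P \o j) inji.
  by move=> x; apply/ic; rewrite /= ej !linear0 addr0.
have [|t tE] := @lin_factor_inj A W _ _ w (snd_lin X P \o i) injw.
  move=> x; apply/wp; rewrite /= -psiE.
  by have := congr1 beta (ci x); rewrite linearD ba add0r linear0.
apply: (IH _ _ s t) dW; split=> [x y xy|z|x].
- by apply: injj; have := congr1 i xy; rewrite !sE => -[].
- have /ab [n nE] : beta (psi (w z)) = 0 by rewrite psiE pw.
  have [x xE] := es (- n).
  have /ic [y yE] : copair_lin (alpha \o e) psi (x, w z) = 0.
    by rewrite /= xE linearN nE addNr.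
  by exists y; apply: injw; rewrite tE /= yE.
- split=> [tx0|[y <-]]; last by apply: injw; rewrite tE /= sE /= linear0.
  have i2 : (i x).2 = 0 by have := tE x; rewrite tx0 linear0.
  have /je [y yE] : e (i x).1 = 0.
    by apply: inja; have := ci x; rewrite i2 !linear0 addr0.
  by exists y; apply: inji; rewrite sE /= [RHS]surjective_pairing i2 yE.
Qed.

(** The value [m] stands outside the condition [i <= n] so that [choice] can turn it into a function
    of all [i]. *)
Lemma dres_resolution k M : dres k M ->
  exists n (C : nat -> rmodType A) (d : forall i, {linear C i.+1 -> C i})
         (e : {linear C 0%N -> M}),
    exact_resolution n d e /\
    forall i, exists m, (i <= n)%N -> dell (i + k) (C i) = Some m.
Proof.
elim=> {k M} [k M fgM dM|k L X M j e [injj es je] fgX dX _ [n [C [d [f [Rd dC]]]]]].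
  have [m mE] := deloops_dell hsyz fgM dM.
  have ids : surjective_lin (idfun : {linear M -> M}) by move=> x; exists x.
  (* The zero module that pads the complex is built as the kernel of an identity map. *)
  have [O [o So]] := ker_ses ids; have o0 := ses0 So; case: So => injo _ _.
  have O0 (x y : O) : x = y by apply: injo; rewrite -[LHS]/(idfun (o x)) o0 -(o0 y).
  exists 0%N, (fun i => if i is i'.+1 then O else M), (fun=> \0), idfun.
  split=> [|[|i]]; last 2 first.
  - by exists m.
  - by exists 0%N.
  split=> // [[|i]|[|i]|y|i y].
  - exact: fgM.
  - by exists 0%N, (fun=> 0) => x; exists (fun=> 0).
  - by [].
  - by move=> _ x.
  - by rewrite /=; split=> [->|[x <-]] //; exists 0.
  - by split=> _ //; exists 0; apply: O0.
have [m mE] := deloops_dell hsyz fgX dX; case: Rd => fgC C0 fs df dd.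
pose C' i := if i is i'.+1 then C i' else X.
pose d' i : {linear C' i.+1 -> C' i} :=
  if i is i'.+1 return {linear C' i.+1 -> C' i} then d i' else j \o f.
exists n.+1, C', d', e; split; last first.
  move=> [|i]; first by exists m.
  by have [m' m'E] := dC i; exists m' => /m'E; rewrite addSnnS.
split=> // [[|i]|[|i] // ni|y|[|i] y].
- exact: fgX.
- exact: fgC.
- exact: C0.
- rewrite je; split=> -[x <-]; last by exists (f x).
  by have [z <-] := fs x; exists z.
- rewrite -df -[d' 0%N y]/(j (f y)); split=> [|->]; last by rewrite linear0.
  by rewrite -[in X in X -> _](linear0 j) => /injj.
- exact: dd.
Qed.

Lemma dres_ddell k M : dres k M -> exists m, ddell k M = Some m.
Proof.
move=> /dres_resolution [n [C [d [e [Rd /choice [m mE]]]]]].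
(* The sum dominates each [m i], and the extra [n] absorbs the subtraction of [i] in [b - i]. *)
pose b := (n + \sum_(i < n.+1) m i)%N.
have [|m' [m'E _]] := @einf_le
  (fun m => exists n : nat, (n <= m)%N /\
    exists (C : nat -> rmodType A) (d : forall i, {linear C i.+1 -> C i})
           (e : {linear C 0%N -> M}),
      exact_resolution n d e /\
      forall i, (i <= n)%N -> ele (dell (i + k) (C i)) (Some (m - i)%N)) b;
  last by exists m'.
exists n; split; first exact: leq_addr.
exists C, d, e; split=> // i le_in; rewrite mE //= /b -addnBAC //.
apply: leq_trans (leq_addl _ _); rewrite -ltnS in le_in.
by rewrite (bigD1 (Ordinal le_in)) //= leq_addr.
Qed.

Lemma einfP (P : nat -> Prop) m : einf P = Some m -> P m.
Proof.
rewrite /einf; case: pselect => // h [<-].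
by case: ex_minnP => n /asboolP.
Qed.

Lemma ddell_iso k M N m : iso_mod M N -> ddell k M = Some m ->
  ele (ddell k N) (Some m).
Proof.
move=> [f [g fg gf]] /einfP [n [nm [C [d [e [[fgC C0 es de dd] hC]]]]]].
have [|m' [m'E m'm]] := @einf_le
  (fun m => exists n : nat, (n <= m)%N /\
    exists (C : nat -> rmodType A) (d : forall i, {linear C i.+1 -> C i})
           (e : {linear C 0%N -> N}),
      exact_resolution n d e /\
      forall i, (i <= n)%N -> ele (dell (i + k) (C i)) (Some (m - i)%N)) m;
  last by rewrite /ddell m'E.
exists n; split=> //; exists C, d, (f \o e); split=> //; split=> // [y|y].
  by have [x xE] := es (g y); exists x; rewrite /= xE gf.
rewrite -de /=; split=> [|->]; last by rewrite linear0.
by rewrite -[in X in X -> _](linear0 f) => /(can_inj fg).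
Qed.

End DeloopingResolutions.

(** * Finite length: projective covers and composition series *)

Section Length.
Variable A : nzRingType.
Implicit Types E K M N P Q S T X Y : rmodType A.

Lemma image_closed M N (f : {linear M -> N}) (U : {pred M}) :
  submod_closed U -> submod_closed [pred y | `[< exists2 x, x \in U & f x = y >]].
Proof.
move=> [U0 UP]; split=> [|a x y]; rewrite !inE.
  by apply/asboolP; exists 0; rewrite ?linear0.
move=> /asboolP [u uU <-] /asboolP [v vU <-]; apply/asboolP.
by exists (a *: u + v); [apply: UP | rewrite linearP].
Qed.

(* Strict monotonicity is all that is needed of the length of submodules. *)
Definition length_fun M (mu : {pred M} -> nat) : Prop :=
  forall U V : {pred M}, submod_closed U -> submod_closed V -> {subset U <= V} ->
    (mu U <= mu V)%N /\ ((mu V <= mu U)%N -> {subset V <= U}).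

Definition finite_length : Prop :=
  forall M, finitely_generated M -> exists mu : {pred M} -> nat, length_fun mu.

Lemma min_measure (T : Type) (P : T -> Prop) (m : T -> nat) :
  (exists x, P x) -> exists2 x, P x & forall y, P y -> (m x <= m y)%N.
Proof.
move=> [x Px]; have : exists n, `[< exists2 y, P y & m y = n >].
  by exists (m x); apply/asboolP; exists x.
move=> h; case: (ex_minnP h) => n /asboolP [y Py <-] min_y.
by exists y => // z Pz; apply: min_y; apply/asboolP; exists z.
Qed.

Lemma setT_closed M : submod_closed (predT : {pred M}).
Proof. by []. Qed.

Hypotheses (hlen : finite_length) (hnoeth : noetherian A).

(* A projective cover of [M] is cut out of a projective [P] over [M] as the
   image of an endomorphism over [M] whose image is as small and whose kernel
   is as large as possible (Fitting's lemma). *)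
Lemma finite_length_syzygies : has_syzygies A.
Proof.
move=> M fgM; have [P [p [[fgP pP] ps]]] := fg_proj_surj fgM.
have [mu muP] := hlen fgP.
pose im (h : {linear P -> P}) : {pred P} := [pred y | `[< exists x, h x = y >]].
pose ker (h : {linear P -> P}) : {pred P} := [pred x | h x == 0].
pose over (h : {linear P -> P}) := forall x, p (h x) = p x.
have [|h hp hmin] := @min_measure _ over
    (fun h => mu (im h) + (mu predT - mu (ker h)))%N.
  by exists idfun.
have{hmin} hmin h' : over h' -> {subset im h' <= im h} -> {subset ker h <= ker h'} ->
    {subset im h <= im h'} /\ {subset ker h' <= ker h}.
  move=> /hmin le_hh' sim sker.
  have [le1 H1] := muP _ _ (im_closed h') (im_closed h) sim.
  have [le2 H2] := muP _ _ (ker_closed h) (ker_closed h') sker.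
  (* This bound makes the truncated subtraction [mu predT - mu (ker h')] exact. *)
  have [//|le3 _] := muP _ _ (ker_closed h') (setT_closed P).
  have {le_hh'} : (mu (im h) + (mu predT - mu (ker h)) <=
    mu (im h') + (mu predT - mu (ker h')))%N by exact: le_hh'.
  rewrite /im /ker in le1 le2 le3 H1 H2 *.
  by move=> le_hh'; split; [apply: H1 | apply: H2]; lia.
have [E [i [inji iE]]] := submod_ex (im_closed h).
have [|r rE] := @lin_factor_inj A E _ _ i h inji.
  by move=> x; apply/iE; rewrite inE; apply/asboolP; exists x.
have rs : surjective_lin r.
  move=> e; have /iE : exists e', i e' = i e by exists e.
  by rewrite inE => /asboolP [x xE]; exists x; apply: inji; rewrite rE.
(* Minimality against [h \o h] makes [h] restrict to an automorphism [r \o i] of its image [E]. *)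
have [imh2 kerh2] : {subset im h <= im (h \o h)} /\ {subset ker (h \o h) <= ker h}.
  apply: hmin => [x|y|x]; first by rewrite /= !hp.
    by rewrite !inE => /asboolP [x <-]; apply/asboolP; exists (h x).
  by rewrite !inE => /eqP /= ->; rewrite linear0.
have gs : surjective_lin (r \o i).
  move=> e; have [x xE] := rs e; have : h x \in im h by rewrite inE; apply/asboolP; exists x.
  move=> /imh2; rewrite inE => /asboolP [y yE]; exists (r y).
  by apply: inji; rewrite /= !rE -xE rE -yE.
have gi : injective (r \o i).
  move=> e e' /(congr1 i); rewrite /= !rE => hee'.
  have [x xE] := rs (e - e'); have : x \in ker (h \o h).
    by rewrite inE /= -(rE x) xE !linearB hee' subrr.
  by move=> /kerh2; rewrite inE -(rE x) xE linearB subr_eq0 => /eqP /inji.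
(* [t] is [r] followed by the inverse of that automorphism, hence a retraction of [i]; so [E] is
   projective. *)
have [t tE] := pP _ _ _ r gs.
have ti : cancel i t by move=> e; apply: gi; rewrite tE.
have qs : surjective_lin (p \o i).
  by move=> y; have [x <-] := ps y; exists (r x); rewrite /= rE hp.
have fgE := fg_surj rs fgP.
have [X [j [injj _ jq]]] := ker_ses qs.
exists X; split; last exact: hnoeth injj fgE.
exists E, (p \o i), j; split=> //; split=> //; first exact: projective_retract ti pP.
move=> U hU Uker; have [Y [k [injk kE]]] := submod_ex hU.
have qks : surjective_lin ((p \o i) \o k).
  move=> y; have [x <-] := qs y; have [u [v [/kE [z zE] v0 ->]]] := Uker x.
  by exists z; rewrite linearD v0 addr0 -zE.
(* Since [U] already maps onto [M], [p] lifts to [Y]. Minimality against the endomorphism through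
   [Y] forces the image of [h] into that of [U]. *)
have [l lE] := pP _ _ _ p qks.
have [||| imh' _] := hmin (i \o (k \o (l \o h))).
- by move=> x; have := lE (h x); rewrite /= hp.
- move=> y; rewrite !inE => /asboolP [x <-]; apply/asboolP.
  have [z zE] := rs (k (l (h x))); exists z.
  by rewrite /= -zE rE.
- by move=> x; rewrite !inE /= => /eqP ->; rewrite !linear0.
move=> x; have [z zE] := rs x.
have : i x \in im h by rewrite inE; apply/asboolP; exists z; rewrite -zE rE.
move=> /imh'; rewrite inE => /asboolP [y /inji <-]; apply/kE.
by exists (l (h y)).
Qed.

(** A nonzero submodule of least measure is simple. *)
Lemma simple_submod M : finitely_generated M -> (exists x : M, x != 0) ->
  exists T (i : {linear T -> M}), simple_mod T /\ injective i.
Proof.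
move=> fgM [x x0]; have [mu muP] := hlen fgM.
have [|U [hU [y yU y0]] Umin] := @min_measure _
    (fun U : {pred M} => submod_closed U /\ exists2 x, x \in U & x != 0) mu.
  by exists (predT : {pred M}); split=> //; exists x.
have [T [i [inji iE]]] := submod_ex hU; exists T, i; split=> //; split.
  have /iE [z zE] := yU; exists z; apply: contraNneq y0 => z0.
  by rewrite -zE z0 linear0.
move=> V hV; have [[v vV v0]|V0] := pselect (exists2 v, v \in V & v != 0); last first.
  by left=> v vV; apply/eqP/negPn/negP => v0; apply: V0; exists v.
right=> z; pose iV := [pred y | `[< exists2 x, x \in V & i x = y >]].
have hiV : submod_closed iV := image_closed i hV.
have /Umin le : submod_closed iV /\ exists2 x, x \in iV & x != 0.
  split=> //; exists (i v); first by rewrite inE; apply/asboolP; exists v.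
  by rewrite -(linear0 i) (inj_eq inji).
have sub : {subset iV <= U}.
  by move=> w; rewrite inE => /asboolP [u _ <-]; apply/iE; exists u.
have [_ /(_ le) sUV] := muP _ _ hiV hU sub.
have : i z \in iV by apply: sUV; apply/iE; exists z.
by rewrite inE => /asboolP [u uV /inji <-].
Qed.

(** Induction on the measure of [M]: split off a simple submodule [T] and apply [dres_ext] to the
    quotient [N]. *)
Lemma dres_filtration k :
  (forall T, simple_mod T -> dres k T) ->
  forall M, finitely_generated M -> dres k M.
Proof.
have hsyz := finite_length_syzygies.
move=> hT M fgM; have [mu] := hlen fgM.
have [d] := ubnP (mu predT); elim: d M fgM mu => // d IHd M fgM mu le_d muP.
have [nz|z] := pselect (exists x : M, x != 0); last first.
  apply: dres_base => //; apply: deloops_zero => // x.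
  by apply/eqP/negPn/negP => x0; apply: z; exists x.
have [T [i [sT inji]]] := simple_submod fgM nz.
have [N [p Sip]] := coker_ses inji; have pi := ses0 Sip.
apply: (dres_ext hsyz hnoeth (hT T sT) Sip).
case: Sip => _ ps ip.
(* Preimages in [M] contain the nonzero image of [T], so subtracting 1 from their measure preserves
   strict monotonicity and makes the total drop. *)
have muT (V : {pred N}) : submod_closed V -> (0 < mu [pred x | p x \in V])%N.
  move=> hV; rewrite lt0n; apply/eqP => mu0.
  have hV' := preim_closed p hV; have h0 := ker_closed (idfun : {linear M -> M}).
  have [|_] := muP _ _ h0 hV'.
    by move=> x; rewrite !inE /= => /eqP ->; rewrite linear0; case: hV.
  rewrite mu0 leq0n => /(_ isT) sub; case: sT => -[t t0] _; case/negP: t0; apply/eqP.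
  apply: inji; rewrite linear0; apply/eqP; have := sub (i t).
  by rewrite !inE pi; case: hV => -> _ /(_ isT).
apply: (IHd N (fg_surj ps fgM) (fun V => (mu [pred x | p x \in V]).-1)).
  have [|le _] := muP _ _ (preim_closed p (setT_closed N)) (setT_closed M); first by [].
  have := muT _ (setT_closed N); rewrite /= in le *; lia.
move=> U V hU hV sUV.
have [x|le H] := muP _ _ (preim_closed p hU) (preim_closed p hV).
  by rewrite !inE => /sUV.
have := muT _ hU; have := muT _ hV => ltV ltU; split; first by lia.
move=> le'; have {}H := H ltac:(lia) => y yV; have [x xE] := ps y.
by have := H x; rewrite !inE xE; apply.
Qed.

End Length.

(** * Local rings and their unique simple module *)

Section LocalRing.
Variable A : nzRingType.
Implicit Types M N S T : rmodType A.

Lemma orbit_surj T (x : T) : simple_mod T -> x != 0 -> surjective_lin (orbit_lin x).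
Proof.
move=> [_ sT] x0 y; case: (sT _ (im_closed (orbit_lin x))) => [im0|/(_ y)].
  case/eqP: x0; apply: im0; rewrite inE; apply/asboolP.
  by exists (1 : A^c); apply: scale1r.
by rewrite inE => /asboolP.
Qed.

Lemma ann_maximal T (x : T) : simple_mod T -> x != 0 ->
  maximal_right_ideal [pred a : regular_rmod A | orbit_lin x a == 0].
Proof.
move=> sT x0; split; first exact: ker_closed.
  by exists (1 : A^c); rewrite inE /= scale1r.
move=> J hJ sIJ; case: (sT) => _ /(_ _ (image_closed (orbit_lin x) hJ)) [im0|imT].
  left=> a; apply/idP/idP => [aJ|/sIJ //]; rewrite inE; apply/eqP; apply: im0.
  by rewrite inE; apply/asboolP; exists a.
(* If [J x = T], write [x = a x] with [a] in [J]; then [1 - a] annihilates [x], so it lies in [J],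
   and so does 1. *)
right=> b; have := imT x; rewrite inE => /asboolP [a aJ ax].
have J1 : (1 : A^c) - a \in J.
  by apply: sIJ; rewrite inE linearB /= scale1r -[a *: x]/(orbit_lin x a) ax subrr.
case: hJ => J0 JP; have := JP 1 _ _ J1 aJ; rewrite scale1r subrK => {}J1.
by have := JP b _ _ J1 J0; rewrite addr0 -[_ *: _]/((b : A^c) * 1) mulr1.
Qed.

Hypothesis hloc : local_ring A.

(** Both are quotients of [A] by the annihilator of a nonzero element, which is the unique maximal
    right ideal. *)
Lemma local_simple_iso S T : simple_mod S -> simple_mod T -> iso_mod S T.
Proof.
move=> sS sT; have [[x x0] _] := sS; have [[y y0] _] := sT.
have [I [_ Iuniq]] := hloc.
have ann (a : regular_rmod A) : orbit_lin x a = 0 <-> orbit_lin y a = 0.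
  have /(_ a) := Iuniq _ (ann_maximal sS x0); have /(_ a) := Iuniq _ (ann_maximal sT y0).
  by rewrite !inE => <- xy; split=> /eqP; [rewrite xy|rewrite -xy] => /eqP.
have xs := orbit_surj sS x0; have ys := orbit_surj sT y0.
have [|f fE] := lin_factor_surj xs (f := orbit_lin y); first by move=> a /ann.
have [|g gE] := lin_factor_surj ys (f := orbit_lin x); first by move=> a /ann.
exists f; exists g => z.
  by have [a <-] := xs z; rewrite fE gE.
by have [a <-] := ys z; rewrite gE fE.
Qed.

Hypotheses (hlen : finite_length A) (hnoeth : noetherian A).

(* The induction on [k] runs on the fact that the simple module [T] is a right
   ideal, hence the syzygy of the cyclic module [A / T]. *)
Lemma local_dres k M : finitely_generated M -> dres k M.
Proof.
have hsyz := finite_length_syzygies hlen hnoeth.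
elim: k M => [|k IHk] M fgM; first exact: dres_base (deloops0 fgM).
apply: (dres_filtration hlen hnoeth _ fgM) => T sT.
have [|T0 [i [sT0 inji]]] := simple_submod hlen (fg_regular A).
  by exists (1 : A^c); apply: oner_neq0.
have [f /bij_inj injf] := local_simple_iso sT sT0.
have [N [p Sp]] := coker_ses (i := i \o f) (inj_comp inji injf).
have fgN : finitely_generated N by case: Sp => _ ps _; apply: fg_surj ps (fg_regular A).
exact: (dres_syz hsyz hnoeth (IHk N fgN) (fgproj_regular A) Sp).
Qed.

Lemma local_ddell k : elt (ddell_ring A k) None.
Proof.
rewrite /ddell_ring /esup; set P := fun b => _.
suff [b Pb] : exists b, P b by have [m [-> _]] := einf_le Pb.
(* Over an empty family any bound works; otherwise the value at one simple module bounds all the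
   isomorphic ones. *)
have [[S sS]|noS] := pselect (exists S : rmodType A, simple_mod S); last first.
  by exists 0%N => v [S [sS _]]; case: noS; exists S.
have fgS : finitely_generated S.
  have [[x x0] _] := sS; exact: fg_surj (orbit_surj sS x0) (fg_regular A).
have hsyz := finite_length_syzygies hlen hnoeth.
have [m mE] := dres_ddell hsyz (local_dres k fgS).
exists m => v [T [sT ->]].
exact: ddell_iso (local_simple_iso sS sT) mE.
Qed.

End LocalRing.

(** * Finite length and noetherianity from dimension *)

Section FiniteDimensional.
Variables (K : fieldType) (A : falgType K).

(** Take a subspace inside [Q] of largest dimension; adding the line of any [x] in [Q] stays inside
    [Q], so [x] was already there. *)
Lemma vspace_of_closed (vT : vectType K) (Q : vT -> Prop) :
  Q 0 -> (forall c x y, Q x -> Q y -> Q (c *: x + y)) ->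
  exists W : {vspace vT}, forall x, x \in W <-> Q x.
Proof.
move=> Q0 QP; have exn : exists n, `[< exists2 W : {vspace vT},
    \dim W = n & forall x, x \in W -> Q x >].
  by exists 0%N; apply/asboolP; exists 0%VS; rewrite ?dimv0 // => x; rewrite memv0 => /eqP->.
have ubn n : `[< exists2 W : {vspace vT}, \dim W = n & forall x, x \in W -> Q x >] ->
    (n <= \dim {:vT})%N.
  by move=> /asboolP [W <- _]; apply: dimvS; apply: subvf.
case: (ex_maxnP exn ubn) => n /asboolP [W <- WQ] maxW; exists W => x.
split=> [/WQ //|Qx]; have sW : (W <= W + <[x]>)%VS by exact: addvSl.
suff le : (\dim (W + <[x]>) <= \dim W)%N.
  by have := eqEdim W (W + <[x]>)%VS; rewrite sW le => /eqP ->; apply: subvP (addvSr W _) _ (memv_line x).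
apply: maxW; apply/asboolP; exists (W + <[x]>)%VS => // y.
move=> /memv_addP [u /WQ Qu [v /vlineP [c ->] ->]].
by rewrite addrC; apply: QP.
Qed.

(* Submodules of [M] correspond to [K]-subspaces of [A^n] along a presentation. *)
Lemma fg_subspaces (M : rmodType A) : finitely_generated M ->
  exists (n : nat) (pi : {ffun 'I_n -> A} -> M),
    [/\ pi 0 = 0, forall c x y, pi (c *: x + y) = (c%:A : A^c) *: pi x + pi y,
        forall y, exists x, pi x = y
      & forall U : {pred M}, submod_closed U ->
          exists W : {vspace {ffun 'I_n -> A}}, forall x, x \in W <-> pi x \in U].
Proof.
move=> [n [g gE]].
pose pi (x : {ffun 'I_n -> A}) : M := \sum_(i < n) (x i : A^c) *: g i.
have piP c x y : pi (c *: x + y) = (c%:A : A^c) *: pi x + pi y.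
  rewrite /pi scaler_sumr -big_split; apply: eq_bigr => i _ /=.
  (* The product of [A^c] is reversed, so acting by [c%:A] multiplies coordinates by it on the right
     in [A]. *)
  by rewrite !ffunE scalerDl scalerA -[in LHS]mulr_algr.
have pi0 : pi 0 = 0 by rewrite /pi big1 // => i _; rewrite ffunE scale0r.
exists n, pi; split=> // [y|U [U0 UP]].
  by have [a ->] := gE y; exists [ffun i => a i]; apply: eq_bigr => i _; rewrite ffunE.
apply: vspace_of_closed => [|c x y Ux Uy]; first by rewrite pi0.
by rewrite piP; apply: UP.
Qed.

Lemma falg_finite_length : finite_length A.
Proof.
move=> M /fg_subspaces [n [pi [_ _ pis piW]]].
(* The measure of a submodule is the dimension of its preimage in [A^n]; other predicates get the
   zero subspace by default. *)
have /choice [W WE] : forall U : {pred M}, exists W : {vspace {ffun 'I_n -> A}},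
    submod_closed U -> forall x, x \in W <-> pi x \in U.
  move=> U; have [/piW [W WE]|nU] := pselect (submod_closed U); first by exists W.
  by exists 0%VS.
exists (fun U => \dim (W U)) => U V hU hV sUV.
have sW : (W U <= W V)%VS.
  by apply/subvP => x /(WE _ hU) /sUV /(WE _ hV).
split=> [|le y yV]; first exact: dimvS.
have := eqEdim (W U) (W V); rewrite sW le => /eqP eqW.
have [x xE] := pis y; rewrite -xE; apply/(WE _ hU); rewrite eqW.
by apply/(WE _ hV); rewrite xE.
Qed.

(** A [K]-basis of the preimage of [N] in [A^n] yields generators of [N], already with coefficients
    from [K]. *)
Lemma falg_noetherian : noetherian A.
Proof.
move=> M N i inji /fg_subspaces [n [pi [pi0 piP pis piW]]].
have [W WE] := piW _ (im_closed i).
(* Stated for every natural [j]: past the basis the default entry is 0, with preimage 0. *)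
have mem j : exists z, i z = pi (vbasis W)`_j.
  case: (ltnP j (\dim W)) => [ltj|lej].
    have /WE : (vbasis W)`_j \in W by apply/vbasis_mem/mem_nth; rewrite size_tuple.
    by rewrite inE => /asboolP.
  rewrite nth_default ?size_tuple //; exists 0.
  by rewrite linear0 pi0.
have /choice [z zE] := mem.
exists (\dim W), (fun j : 'I__ => z j) => y.
have [x xE] := pis (i y); have xW : x \in W by apply/WE; rewrite inE xE; apply/asboolP; exists y.
exists (fun j => (coord (vbasis W) j x)%:A : A^c); apply: inji.
rewrite linear_sum -xE {1}(coord_vbasis xW).
under [RHS]eq_bigr => j _ do rewrite linearZ /= zE.
elim/big_rec2: _ => // j u v _ <-.
by rewrite piP.
Qed.

End FiniteDimensional.

Theorem theorem3p3 (K : fieldType) (A : falgType K) (hloc : local_ring A)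
    (k : nat) (hk : (1 <= k)%N) :
  elt (ddell_ring A k) None.
Proof.
exact: (local_ddell hloc (@falg_finite_length K A) (@falg_noetherian K A)).
Qed.
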